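(* Let $(X,\|\cdot\|)$ be a Banach space and let $f:X\to X$ be of class $C^1$. Suppose that $f'(x)$ is invertible for every $x\in X$ and that there is a constant $M>0$ such that $$\|[f'(x)]^{-1}\|\le M,\qquad \forall x\in X.$$ Let $K\subset X$ be compact. Then $f$ has a continuous right inverse on $K$, that is, there is a continuous function $g:K\to X$ such that $$f(g(x))=x,\qquad \forall x\in K.$$ Moreover, if $f(0)=0$ and $0\in K$, then there is a continuous function $g:K\to X$ such that $f(g(x))=x$ for all $x\in K$ and $g(0)=0$.
   Context: A function $f:X\to X$ is Fréchet differentiable at $x\in X$ if there is a bounded linear operator $f'(x):X\to X$ such that $\lim_{\|h\|\to 0}\frac{f(x+h)-f(x)-f'(x)h}{\|h\|}=0$. The function $f$ is of class $C^1$ (smooth) if it is Fréchet differentiable at every point of $X$ and the map $x\mapsto f'(x)$ is norm-to-norm continuous (with the operator norm on bounded linear operators). Invertibility of $f'(x)$ means invertibility as a bounded linear operator on $X$, and $\|[f'(x)]^{-1}\|$ is the operator norm of the inverse. Compactness of $K$ is with respect to the norm topology of $X$. *)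

(* Defs.v *)
From HB Require Import structures.
From mathcomp Require Import all_boot all_order all_algebra.
From mathcomp Require Import all_classical all_reals all_analysis.
Import Order.TTheory GRing.Theory Num.Theory.
Import numFieldNormedType.Exports.

Set Implicit Arguments.
Unset Strict Implicit.
Unset Printing Implicit Defensive.

Local Open Scope classical_set_scope.
Local Open Scope ring_scope.

Section BoundedOperators.
Context {R : realType} {V W : normedModType R}.

(* [sup] is [0] on sets without an upper bound, so this is the operator norm
   only when [L] is a bounded linear map. *)
Definition opnorm (L : V -> W) : R :=
  sup [set `|L h| | h in [set h : V | `|h| <= 1]].

(* Boundedness of the inverse is stated as continuity, which is equivalent for
   linear maps by [linear_bounded_continuous]. *)
Definition is_inverse_operator (L : V -> W) (G : {linear W -> V}) : Prop :=
  [/\ continuous G, cancel L G & cancel G L].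

Definition invertible_operator (L : V -> W) : Prop :=
  exists G : {linear W -> V}, is_inverse_operator L G.

(* Arbitrary when [L] is not invertible. *)
Definition inverse_operator (L : V -> W) : {linear W -> V} :=
  get (is_inverse_operator L).

Definition of_class_C1 (f : V -> W) : Prop :=
  (forall x, differentiable f x) /\
  (forall x, opnorm (fun h => 'd f y h - 'd f x h) @[y --> x] --> (0 : R)).

End BoundedOperators.

(* Main.v *)
(* Solve f o u = id on K by minimising the residual sup_K |f(u x) - x| over
   continuous u : K -> X. The Newton direction w(x) = f'(u x)^-1 (x - f(u x)) is
   continuous in x and bounded by M times the residual; compactness of K makes
   the first-order expansion of f along w uniform on K, so that a short step t w
   multiplies the residual by at most 1 - t/2 while moving u by at most t M times
   the residual. A decrease of the residual thus controls the displacement, so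
   descending sequences converge uniformly, and the Brezis-Browder ordering
   principle yields a u whose residual cannot be decreased, hence is zero. The
   direction w vanishes wherever u is already exact, so starting from u = 0 the
   value u (f 0) = 0 is never changed. *)

Require Import Defs.
From HB Require Import structures.
From mathcomp Require Import all_boot all_order all_algebra.
From mathcomp Require Import all_classical all_reals all_analysis.
From mathcomp Require Import ring lra.
Import Order.TTheory GRing.Theory Num.Theory.
Import numFieldNormedType.Exports.

Local Open Scope classical_set_scope.
Local Open Scope ring_scope.

(** * The ordering principle *)

(** Build a descending sequence in which each [s n.+1] takes [phi] at least halfway from [phi (s n)]
    towards every value attained below [s n]. A point [c] below a lower bound [b] of the sequence
    lies below every [s n], so with [L] the infimum of [phi] along the sequence,
    [2 * L - phi c <= phi (s n)] for all [n]. Hence [phi b <= L <= phi c]. *)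
Lemma brezis_browder {R : realType} {T : Type} (le : T -> T -> Prop)
    (phi : T -> R) (a0 : T) :
  (forall a, le a a) ->
  (forall a b c, le a b -> le b c -> le a c) ->
  (forall a b, le a b -> phi a <= phi b) ->
  (forall a, 0 <= phi a) ->
  (forall s : nat -> T, (forall n, le (s n.+1) (s n)) ->
    exists b, forall n, le b (s n)) ->
  exists b, forall c, le c b -> phi b <= phi c.
Proof.
move=> le_refl le_trans phi_mono phi_ge0 seq_lb.
have halve a : exists b,
    le b a /\ forall c, le c a -> phi b <= (phi a + phi c) / 2.
  pose E := [set phi c | c in le^~ a].
  have lbE : has_lbound E by exists 0 => _ [c _ <-].
  have infE : has_inf E by split=> //; exists (phi a), a.
  have infE_le c : le c a -> inf E <= phi c.
    by move=> ca; apply: ge_inf => //; exists c.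
  have [lt_inf|ge_inf] := ltP (inf E) (phi a).
    have e_gt0 : 0 < (phi a - inf E) / 2 by lra.
    have [_ [b ba <-] b_lt] := inf_adherent e_gt0 infE.
    by exists b; split=> // c /infE_le; lra.
  by exists a; split=> // c /infE_le; lra.
have [next nextP] := choice halve.
pose s n := iter n next a0.
have s_dec n : le (s n.+1) (s n) by have [] := nextP (s n).
have [b b_le] := seq_lb _ s_dec.
exists b => c cb.
pose L := inf (range (phi \o s)).
have lbL : has_lbound (range (phi \o s)) by exists 0 => _ [n _ <-] /=.
have bL : phi b <= L.
  by apply: lb_le_inf => [|_ [n _ <-]];
    [exists (phi (s 0%N)), 0%N|exact: phi_mono].
have step n : 2 * L - phi c <= phi (s n).
  have [_ /(_ c (le_trans _ _ _ cb (b_le n)))] := nextP (s n).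
  have : L <= phi (s n.+1) by apply: ge_inf => //; exists n.+1.
  rewrite -[next (s n)]/(s n.+1); lra.
have : 2 * L - phi c <= L.
  by apply: lb_le_inf => [|_ [n _ <-]]; [exists (phi (s 0%N)), 0%N|exact: step].
lra.
Qed.

(** * Operator norm and strict differentiability of C1 maps *)

Lemma le_opnorm {R : realType} {V W : normedModType R} (L : {linear V -> W})
    (h : V) :
  continuous L -> `|L h| <= opnorm L * `|h|.
Proof.
move=> /linear_bounded_continuous/linear_boundedP/pinfty_ex_gt0 [r r_gt0 L_le].
(* Boundedness keeps the [sup] in [opnorm] from taking its default value 0. *)
have ubL : has_ubound [set `|L h| | h in [set h : V | `|h| <= 1]].
  exists r => _ [k k_le1 <-]; apply: le_trans (L_le k) _.
  by rewrite ler_piMr // ltW.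
have [->|h_neq0] := eqVneq h 0; first by rewrite linear0 !normr0 mulr0.
rewrite -ler_pdivrMr ?normr_gt0 //.
apply: ub_le_sup ubL _ _; exists (`|h|^-1 *: h) => /=.
  by rewrite normrZ normfV normr_id mulVf ?normr_eq0.
by rewrite linearZ normrZ normfV normr_id mulrC.
Qed.

(** A mean value inequality for vector-valued paths. The times up to which the bound holds from 0
    contain their supremum [T], and the local bound at [T] would carry it past [T] if [T < 1]. *)
Lemma local_increment_le {R : realType} {V : normedModType R} (g : R -> V)
    (e : R) :
  (forall t : R, 0 <= t <= 1 ->
    \forall s \near t, `|g s - g t| <= e * `|s - t|) ->
  `|g 1 - g 0| <= e.
Proof.
move=> g_loc.
pose S := [set t : R | 0 <= t <= 1 /\ `|g t - g 0| <= e * t].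
have S0 : S 0 by split; rewrite ?lexx ?ler01 // subrr normr0 mulr0.
have ubS : has_ubound S by exists 1 => t [/andP[]].
have supS : has_sup S by split; first by exists 0.
set T := sup S.
have T01 : 0 <= T <= 1.
  rewrite ub_le_sup //=; apply: ge_sup; first by exists 0.
  by move=> t [/andP[]].
have /nbhs_ballP[d /= d_gt0 g_near] := g_loc T T01.
have ST : S T.
  have [s [s01 gs]] := sup_adherent d_gt0 supS; rewrite -/T => s_gt.
  have s_le : s <= T by apply: ub_le_sup.
  split=> //.
  have sT : `|T - s| = T - s by rewrite ger0_norm; lra.
  have := g_near s; rewrite /ball /= sT => /(_ ltac:(lra)).
  rewrite (distrC s) sT => gTs.
  by have := ler_distD (g s) (g T) (g 0); rewrite (distrC (g T) (g s)); lra.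
have [T_ge1|T_lt1] := leP 1 T.
  have T1 : T = 1 by lra.
  by case: ST => _; rewrite T1 mulr1.
pose s := Num.min 1 (T + d / 2).
have s_gt : T < s by rewrite lt_min T_lt1; lra.
have s_lt : s < T + d by rewrite gt_min; apply/orP; right; lra.
suff : s <= T by lra.
apply: ub_le_sup => //; split.
  by rewrite (le_trans _ (ltW s_gt)) ?ge_min ?lexx //; case/andP: T01.
have := g_near s; rewrite /ball /= (distrC T).
rewrite (ger0_norm (x := s - T)); last lra.
move=> /(_ ltac:(lra)) gsT.
by have := ler_distD (g T) (g s) (g 0); case: ST; lra.
Qed.

Lemma differentiable_near {R : realType} {V W : normedModType R} {f : V -> W}
    {x : V} {e : R} :
  differentiable f x -> 0 < e ->
  \forall h \near 0, `|f (x + h) - f x - 'd f x h| <= e * `|h|.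
Proof.
move=> /diff_locally/eqaddoP fx e_gt0; have := fx e e_gt0.
apply: filterS => h; rewrite /cst /= !fctE /= opprD addrA [h + x]addrC.
exact.
Qed.

Lemma C1_diff_near {R : realType} {V W : normedModType R} {f : V -> W}
    (x : V) {e : R} :
  of_class_C1 f -> 0 < e ->
  \forall y \near x, forall h, `|'d f y h - 'd f x h| <= e * `|h|.
Proof.
move=> [f_diff df_cont] e_gt0.
have /cvgrPdist_lt /(_ e e_gt0) := df_cont x; apply: filterS => y.
rewrite sub0r normrN => df_lt h.
have cont_dfB : continuous ('d f y \- 'd f x).
  by move=> z; apply: cvgB; apply: diff_continuous.
apply: le_trans (le_opnorm ('d f y \- 'd f x) h cont_dfB) _.
by rewrite ler_wpM2r // (le_trans _ (ltW df_lt)) // ler_norm.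
Qed.

Lemma ball_segment {R : realType} {V : normedModType R} (x y z : V) (d t : R) :
  0 <= t <= 1 -> ball x d y -> ball x d z -> ball x d (y + t *: (z - y)).
Proof.
move=> /andP[t_ge0 t_le1]; rewrite -ball_normE /= => xy xz.
have -> : x - (y + t *: (z - y)) = (1 - t) *: (x - y) + t *: (x - z).
  rewrite scalerBl scale1r -addrA [- _ + _]addrC -scalerBr opprB.
  by rewrite [x - z + _]addrC subrKA opprD addrA -scalerN opprB.
apply: le_lt_trans (ler_normD _ _) _; rewrite !normrZ.
rewrite (ger0_norm t_ge0) ger0_norm ?subr_ge0 //.
(* Strictness comes from [xz], which survives scaling by [t] only if [t] is positive; at [t = 0] it
   comes from [xy]. *)
have [->|t_neq0] := eqVneq t 0; first by rewrite subr0 mul1r mul0r addr0.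
have t_gt0 : 0 < t by rewrite lt_neqAle eq_sym t_neq0.
have := ler_wpM2l (x := 1 - t) _ (ltW xy); rewrite subr_ge0 => /(_ t_le1).
by rewrite -(ltr_pM2l t_gt0) in xz; lra.
Qed.

(** Subtract ['d f y] and apply the mean value inequality along the segment from [y] to [z]. At a
    point [p] of it, differentiability costs [e / 2], and comparing ['d f p] and ['d f y] with
    ['d f x] costs [e / 4] each. The radius [d] serves all base points [y] near [x], as compactness
    will require. *)
Lemma C1_strictly_differentiable {R : realType} {V W : normedModType R}
    {f : V -> W} (x : V) {e : R} :
  of_class_C1 f -> 0 < e ->
  exists2 d : R, 0 < d & forall y z, ball x d y -> ball x d z ->
    `|f z - f y - 'd f y (z - y)| <= e * `|z - y|.
Proof.
move=> f_C1 e_gt0.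
have e4_gt0 : 0 < e / 4 by lra.
have e2_gt0 : 0 < e / 2 by lra.
have /nbhs_ballP[d /= d_gt0 df_near] := C1_diff_near x f_C1 e4_gt0.
exists d => // y z xy xz; set h := z - y.
pose g (s : R) := f (y + s *: h) - 'd f y (s *: h).
have -> : f z - f y - 'd f y h = g 1 - g 0.
  rewrite /g !scale1r !scale0r linear0 addr0 subr0 /h [y + _]addrC subrK.
  by rewrite addrAC.
apply: local_increment_le => t t01.
set p := y + t *: h.
have xp : ball x d p by apply: ball_segment.
have f_near := differentiable_near (f_C1.1 p) e2_gt0.
have h_cvg : (s - t) *: h @[s --> t] --> (0 : V).
  rewrite -[X in _ --> X](scale0r h) -(subrr t).
  by apply: cvgZ; [apply: cvgB; [exact: cvg_id|]|]; exact: cvg_cst.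
have : \forall s \near t, let k := (s - t) *: h in
    `|f (p + k) - f p - 'd f p k| <= e / 2 * `|k| by exact: h_cvg _ f_near.
apply: filterS => s /=.
set k := (s - t) *: h => f_le.
have -> : g s - g t = (f (p + k) - f p - 'd f p k) + ('d f p k - 'd f y k).
  rewrite /g (_ : y + s *: h = p + k); last first.
    by rewrite /p -addrA -scalerDl subrKC.
  rewrite (_ : s *: h = t *: h + k); last by rewrite -scalerDl subrKC.
  rewrite linearD addrA subrK opprB.
  by rewrite opprD (addrC (- 'd f y (t *: h))) -addrA subrKA addrA addrAC.
have k_norm : `|k| = `|s - t| * `|h| by rewrite normrZ.
have dpk := df_near p xp k; have dyk := df_near y xy k.
have := ler_normD (f (p + k) - f p - 'd f p k) ('d f p k - 'd f y k).
have := ler_distD ('d f x k) ('d f p k) ('d f y k).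
rewrite (distrC ('d f x k)).
suff : e * `|h| * `|s - t| = e * `|k| by lra.
by rewrite k_norm; ring.
Qed.

(** * Inverse derivatives and the Newton step *)

Lemma inverse_operatorP {R : realType} {V W : normedModType R} {L : V -> W} :
  invertible_operator L -> is_inverse_operator L (inverse_operator L).
Proof. exact: getPex. Qed.

(** With [z] the claimed limit and [G] the inverse of ['d f (y_ i)], the error is
    [G (w_ i - 'd f (y_ i) z)]. The uniform bound [M] on [G] reduces the claim to ['d f (y_ i) z]
    tending to ['d f y z = w]. *)
Lemma inverse_diff_cvg {R : realType} {V W : normedModType R} {f : V -> W}
    {M : R} {T : Type} {F : set_system T} {FF : Filter F}
    {y_ : T -> V} {w_ : T -> W} {y : V} {w : W} :
  of_class_C1 f -> (forall x, invertible_operator ('d f x)) ->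
  (forall x, opnorm (inverse_operator ('d f x)) <= M) ->
  y_ @ F --> y -> w_ @ F --> w ->
  inverse_operator ('d f (y_ i)) (w_ i) @[i --> F]
    --> inverse_operator ('d f y) w.
Proof.
move=> f_C1 df_inv df_inv_le y_cvg w_cvg.
set z := inverse_operator ('d f y) w.
have dz_cvg : 'd f (y_ i) z @[i --> F] --> 'd f y z.
  apply/cvgrPdist_le => e e_gt0.
  have e'_gt0 : 0 < e / (`|z| + 1) by rewrite divr_gt0 // ltr_wpDl.
  have : \forall i \near F, forall h,
      `|'d f (y_ i) h - 'd f y h| <= e / (`|z| + 1) * `|h|.
    exact: y_cvg _ (C1_diff_near y f_C1 e'_gt0).
  apply: filterS => i /(_ z).
  rewrite distrC => /le_trans; apply.
  by rewrite mulrAC ler_pdivrMr ?ltr_wpDl // ler_pM2l // lerDl.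
have z_eq : 'd f y z = w by have [_ _] := inverse_operatorP (df_inv y); apply.
rewrite z_eq in dz_cvg.
have res_cvg : M * `|w_ i - 'd f (y_ i) z| @[i --> F] --> 0.
  rewrite -[X in _ --> X](mulr0 M) -(normr0 W) -(subrr w).
  by apply: cvgM; [exact: cvg_cst|apply: cvg_norm; apply: cvgB].
apply/cvgrPdistC_le => e e_gt0.
have /cvgr_le /(_ e e_gt0) := res_cvg; apply: filterS => i; apply: le_trans.
have [G_cont dfK _] := inverse_operatorP (df_inv (y_ i)).
rewrite -{1}(dfK z) -linearB.
apply: le_trans (le_opnorm _ _ G_cont) _.
by rewrite ler_wpM2r.
Qed.

(* [r] is any upper bound of the residual, not its supremum. *)
Definition approx_inverse {R : realType} {X : normedModType R} (f : X -> X)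
    (K : set X) (u : X -> X) (r : R) : Prop :=
  [/\ {within K, continuous u}, K (f 0) -> u (f 0) = 0, 0 <= r &
      forall x, K x -> `|f (u x) - x| <= r].

(** The order fed to the Brezis-Browder principle: displacement is paid for by decrease of the
    residual bound, so costs telescope along chains. *)
Definition improves {R : realType} {X : normedModType R} (K : set X) (c : R)
    (b a : (X -> X) * R) : Prop :=
  b.2 <= a.2 /\ forall x, K x -> `|b.1 x - a.1 x| <= c * (a.2 - b.2).

Lemma newton_step {R : realType} {X : normedModType R} {f : X -> X} {M : R}
    {K : set X} {u : X -> X} {r : R} :
  of_class_C1 f -> (forall x, invertible_operator ('d f x)) -> 0 < M ->
  (forall x, opnorm (inverse_operator ('d f x)) <= M) ->
  compact K -> approx_inverse f K u r -> 0 < r ->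
  exists v s, [/\ approx_inverse f K v s, s < r &
    improves K (2 * M) (v, s) (u, r)].
Proof.
move=> f_C1 df_inv M_gt0 df_inv_le.
move=> /compact_near_coveringP/near_covering_withinP K_cover.
move=> [/subspace_continuousP u_cont u0 _ u_res] r_gt0.
pose w x := inverse_operator ('d f (u x)) (x - f (u x)).
have w_le x : K x -> `|w x| <= M * r.
  move=> Kx; have [G_cont _ _] := inverse_operatorP (df_inv (u x)).
  apply: le_trans (le_opnorm _ _ G_cont) _.
  apply: le_trans (ler_wpM2r (normr_ge0 _) (df_inv_le _)) _.
  by rewrite ler_pM2l // distrC u_res.
(* As [w] is bounded by [M * r], this makes the remainder at most [t / 2 * r], half of the
   first-order gain [t * r]. *)
pose e := (2 * M)^-1.
have e_gt0 : 0 < e by rewrite invr_gt0 mulr_gt0.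
pose small t x : Prop := `|f (u x + t *: w x) - f (u x) - 'd f (u x) (t *: w x)|
  <= e * `|t *: w x|.
have [t [t_gt0 t_le1 t_rem]] : exists t : R,
    [/\ 0 < t, t <= 1 & K `<=` small t].
  suff /filter_ex [t [[t_gt0 t_le1] t_rem]] :
      \forall t \near (0 : R)^'+, (0 < t /\ t <= 1) /\ K `<=` small t.
    by exists t; split.
  apply: filterI; first apply: filterI.
  - exact: nbhs_right_gt.
  - exact: nbhs_right_le.
  (* The near-covering form of compactness: bounds valid near each [x] for all small [t > 0] yield
     one [t] valid on all of [K]. *)
  apply: (K_cover R (0 : R)^'+ small _ _) => x Kx.
  have [d d_gt0 f_strict] := C1_strictly_differentiable (u x) f_C1 e_gt0.
  have d2_gt0 : 0 < d / 2 by rewrite divr_gt0.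
  (* Half of the radius [d] is spent on moving from [u x] to [u x'], the other half on the step
     [t *: w x']. *)
  pose del := d / 2 / (M * r).
  have del_gt0 : 0 < del by rewrite divr_gt0 // mulr_gt0.
  exists ([set x' | K x' -> ball (u x) (d / 2) (u x')],
    [set t | 0 < t /\ t < del]).
    split; first by apply: (u_cont x Kx); exact: nbhsx_ballx.
    by apply: filterI; [exact: nbhs_right_gt|exact: nbhs_right_lt].
  move=> [x' t] /= [/[swap] [[t_gt0 t_lt]] ux'] Kx'.
  have := f_strict (u x') (u x' + t *: w x').
  rewrite (addrAC (u x') _ (- u x')) subrr add0r; apply.
    by apply: le_ball (ux' Kx'); lra.
  move: (ux' Kx'); rewrite -ball_normE /= => ux_lt.
  have tw_le : t * `|w x'| <= t * (M * r) by rewrite ler_pM2l // w_le.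
  have tMr_lt : t * (M * r) < d / 2 by rewrite -ltr_pdivlMr // mulr_gt0.
  rewrite opprD addrA; apply: le_lt_trans (ler_normB _ _) _.
  by rewrite normrZ gtr0_norm //; lra.
pose v x := u x + t *: w x.
exists v, ((1 - t / 2) * r); split.
- split.
  + apply/subspace_continuousP => x Kx.
    have ux_cvg : u y @[y --> within K (nbhs x)] --> u x := u_cont x Kx.
    suff w_cvg : w y @[y --> within K (nbhs x)] --> w x.
      exact: cvgD ux_cvg (cvgZ (cvg_cst t) w_cvg).
    apply: (inverse_diff_cvg f_C1 df_inv df_inv_le ux_cvg).
    apply: cvgB; first exact: cvg_within.
    apply: continuous_cvg ux_cvg; exact: differentiable_continuous (f_C1.1 _).
  + by move=> Kf0; rewrite /v /w u0 // subrr linear0 scaler0 addr0.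
  + by rewrite mulr_ge0 // ?ltW //; lra.
  + move=> x Kx.
    (* The Newton equation for [w x] makes the linear term cancel the fraction [t] of the
       residual. *)
    have -> : f (v x) - x = (f (v x) - f (u x) - 'd f (u x) (t *: w x)) +
        (1 - t) *: (f (u x) - x).
      have -> : 'd f (u x) (t *: w x) = t *: (x - f (u x)).
        have [_ _ wK] := inverse_operatorP (df_inv (u x)).
        by rewrite linearZ wK.
      rewrite scalerBl scale1r -[- (t *: (x - _))]scalerN opprB addrACA subrr.
      by rewrite addr0 subrKA.
    have res := t_rem x Kx; rewrite /small -/(v x) in res.
    have e_eq : e * (t * (M * r)) = t / 2 * r.
      by rewrite /e; field; rewrite gt_eqF.
    have tw_le : e * `|t *: w x| <= t / 2 * r.
      by rewrite -e_eq normrZ gtr0_norm // !ler_pM2l // w_le.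
    have t1_ge0 : 0 <= 1 - t by rewrite subr_ge0.
    have ux_le := ler_wpM2l t1_ge0 (u_res x Kx).
    apply: le_trans (ler_normD _ _) _.
    by rewrite normrZ (ger0_norm t1_ge0); lra.
- by rewrite gtr_pMl //; lra.
- split => /= [|x Kx].
    by rewrite ger_pMl //; lra.
  rewrite /v addrAC subrr add0r normrZ gtr0_norm //.
  have := ler_wpM2l (ltW t_gt0) (w_le x Kx).
  (* The factor [2 * M] is the ratio of the displacement bound [t * (M * r)] to the decrease
     [t / 2 * r]. *)
  suff -> : 2 * M * (r - (1 - t / 2) * r) = t * (M * r) by [].
  by field.
Qed.

(** * Descending sequences and their limits *)

Lemma improves_refl {R : realType} {X : normedModType R} (K : set X) (c : R)
    (a : (X -> X) * R) :
  improves K c a a.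
Proof. by split=> // x _; rewrite !subrr normr0 mulr0. Qed.

Lemma improves_trans {R : realType} {X : normedModType R} {K : set X} {c : R}
    {b a d : (X -> X) * R} :
  improves K c a b -> improves K c b d -> improves K c a d.
Proof.
move=> [ab2 ab1] [bd2 bd1]; split=> [|x Kx]; first exact: le_trans bd2.
have := ler_distD (b.1 x) (a.1 x) (d.1 x).
by have := ab1 x Kx; have := bd1 x Kx; lra.
Qed.

Lemma improves_chain {R : realType} {X : normedModType R} {K : set X} {c : R}
    {s : nat -> (X -> X) * R} {n m : nat} :
  (forall i, improves K c (s i.+1) (s i)) -> (n <= m)%N ->
  improves K c (s m) (s n).
Proof.
move=> s_step; elim: m => [|m IHm].
  by rewrite leqn0 => /eqP ->; exact: improves_refl.
rewrite leq_eqVlt => /predU1P[->|/IHm]; first exact: improves_refl.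
exact: improves_trans (s_step m).
Qed.

(** This supplies the lower bounds of descending sequences. The residual bounds converge, being
    monotone and nonnegative, and their tails dominate the displacements uniformly on [K];
    completeness then gives a uniform limit, which inherits continuity. *)
Lemma approx_inverse_limit {R : realType} {X : completeNormedModType R}
    {f : X -> X} {K : set X} {c : R} {s : nat -> (X -> X) * R} :
  (forall x, {for x, continuous f}) -> 0 < c ->
  (forall n, approx_inverse f K (s n).1 (s n).2) ->
  (forall n, improves K c (s n.+1) (s n)) ->
  exists u r, approx_inverse f K u r /\ forall n, improves K c (u, r) (s n).
Proof.
move=> f_cont c_gt0 s_approx s_step.
have s_chain n m := @improves_chain _ _ _ _ _ n m s_step.
pose rs n := (s n).2.
have rs_dec : nonincreasing_seq rs by move=> n m /s_chain[].
have rs_ge0 n : 0 <= rs n by have [] := s_approx n.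
have rs_cvg : cvgn rs.
  by apply: nonincreasing_is_cvgn => //; exists 0 => _ [n _ <-].
pose r := limn rs.
have r_le n : r <= rs n by exact: nonincreasing_cvgn_ge.
have r_ge0 : 0 <= r by apply: limr_ge => //; exact: nearW.
(* Replacing [rs m] by its lower bound [r] makes the estimate independent of [m]. *)
have dist_le n m x : K x -> (n <= m)%N ->
    `|(s m).1 x - (s n).1 x| <= c * (rs n - r).
  move=> Kx /s_chain[_ /(_ x Kx) /le_trans]; apply.
  by rewrite ler_pM2l // lerB // r_le.
have small_tail e : 0 < e -> exists n, c * (rs n - r) < e.
  move=> e_gt0.
  have /cvgrPdistC_lt /(_ (e / c) (divr_gt0 e_gt0 c_gt0))
    [n _ /(_ n (leqnn n))] :
    rs @ \oo --> r by [].
  rewrite ger0_norm ?subr_ge0 // ltr_pdivlMr // mulrC; by exists n.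
(* Off [K] the sequence may diverge, and [u x] is then a default value; only points of [K] are used
   below. *)
pose u x := limn (fun n => (s n).1 x).
have u_cvg x : K x -> (s n).1 x @[n --> \oo] --> u x.
  move=> Kx; apply/cauchy_cvgP/cauchy_exP => e e_gt0.
  have [n n_lt] := small_tail e e_gt0; exists ((s n).1 x), n => // m /= nm.
  by rewrite -ball_normE /= distrC; apply: le_lt_trans n_lt; exact: dist_le.
have u_le n x : K x -> `|u x - (s n).1 x| <= c * (rs n - r).
  move=> Kx.
  have lhs_cvg : `|(s m).1 x - (s n).1 x| @[m --> \oo] --> `|u x - (s n).1 x|.
    by apply: cvg_norm; apply: cvgB; [exact: u_cvg|exact: cvg_cst].
  apply: ler_cvg_to lhs_cvg (cvg_cst _) _.
  by exists n => // m /= nm; exact: dist_le.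
exists u, r; split; last by move=> n; split=> [|x]; [exact: r_le|exact: u_le].
split=> //.
- apply/subspace_continuousP => x Kx; apply/cvgrPdist_lt => e e_gt0.
  have e3_gt0 : 0 < e / 3 by rewrite divr_gt0.
  have [n n_lt] := small_tail _ e3_gt0.
  have [/subspace_continuousP /(_ x Kx) sn_cont _ _ _] := s_approx n.
  have sn_near : \forall y \near within K (nbhs x),
      `|(s n).1 x - (s n).1 y| < e / 3.
    by have /cvgrPdist_lt /(_ _ e3_gt0) := sn_cont.
  apply: filterS2 (withinT K _) sn_near => y Ky sn_lt.
  have ux := u_le n x Kx; have uy := u_le n y Ky.
  have := ler_distD ((s n).1 x) (u x) (u y).
  have := ler_distD ((s n).1 y) ((s n).1 x) (u y).
  by rewrite (distrC ((s n).1 y) (u y)); lra.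
- move=> Kf0; rewrite /u (_ : (fun n => (s n).1 (f 0)) = cst 0) ?lim_cst //.
  by apply/funext => n; have [_ ->] := s_approx n.
- move=> x Kx.
  have lhs_cvg : `|f ((s n).1 x) - x| @[n --> \oo] --> `|f (u x) - x|.
    apply: cvg_norm; apply: cvgB; last exact: cvg_cst.
    exact: continuous_cvg (f_cont _) (u_cvg x Kx).
  apply: ler_cvg_to lhs_cvg rs_cvg _.
  by apply: nearW => n; have [_ _ _] := s_approx n; apply.
Qed.

(** * Existence of the right inverse *)

Lemma exists_approx_inverse {R : realType} {X : normedModType R}
    {f : X -> X} {K : set X} :
  compact K -> exists r, approx_inverse f K (cst 0) r.
Proof.
move=> /compact_bounded/pinfty_ex_gt0 [r r_gt0 K_le].
exists (`|f 0| + r); split.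
- by apply: continuous_subspaceT => x; exact: cvg_cst.
- by [].
- by rewrite addr_ge0 // ltW.
- move=> x Kx; apply: le_trans (ler_normB _ _) _.
  by rewrite lerD2l; exact: K_le.
Qed.

(** Normalising at [f 0] instead of 0 lets a single [g] serve both claims of the theorem: it is
    consistent for any [f], and becomes [g 0 = 0] when [f 0 = 0]. *)
Lemma right_inverse_on_compact {R : realType} {X : completeNormedModType R}
    {f : X -> X} {M : R} {K : set X} :
  of_class_C1 f -> (forall x, invertible_operator ('d f x)) -> 0 < M ->
  (forall x, opnorm (inverse_operator ('d f x)) <= M) -> compact K ->
  exists g : X -> X, [/\ {within K, continuous g},
    forall x, K x -> f (g x) = x & K (f 0) -> g (f 0) = 0].
Proof.
move=> f_C1 df_inv M_gt0 df_inv_le K_compact.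
have c_gt0 : 0 < 2 * M by rewrite mulr_gt0.
have f_cont x : {for x, continuous f}.
  exact: differentiable_continuous (f_C1.1 x).
(* Carrying the invariant in the type makes minimality range over approximate inverses only. *)
pose state := {a : (X -> X) * R | approx_inverse f K a.1 a.2}.
have [r0 r0P] := @exists_approx_inverse _ _ f _ K_compact.
have [] := @brezis_browder R state
  (fun b a => improves K (2 * M) (sval b) (sval a)) (fun a => (sval a).2)
  (exist _ (_, r0) r0P).
- by move=> a; exact: improves_refl.
- by move=> a b c; exact: improves_trans.
- by move=> a b [].
- by move=> [a []].
- move=> s s_step.
  have [u [r [ur ur_le]]] := approx_inverse_limit f_cont c_gt0
    (fun n => svalP (s n)) s_step.
  by exists (exist _ (u, r) ur).
move=> [[u r] /= ur] r_min; have [u_cont u0 r_ge0 u_res] := ur.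
(* A positive minimal bound would be lowered by a Newton step. *)
have [r_gt0|r_le0] := ltP 0 r.
  have [v [t [vt t_lt vt_le]]]
    := newton_step f_C1 df_inv M_gt0 df_inv_le K_compact ur r_gt0.
  by have := r_min (exist _ (v, t) vt) vt_le; rewrite /= leNgt t_lt.
exists u; split=> // x Kx.
by apply/eqP; rewrite -subr_eq0 -normr_le0; exact: le_trans (u_res x Kx) r_le0.
Qed.

Theorem proposition1 (R : realType) (X : completeNormedModType R) (f : X -> X)
    (f_C1 : of_class_C1 f)
    (df_inv : forall x : X, invertible_operator ('d f x))
    (M : R) (M_gt0 : 0 < M)
    (df_inv_le : forall x : X, opnorm (inverse_operator ('d f x)) <= M)
    (K : set X) (K_compact : compact K) :
  (exists g : X -> X,
      {within K, continuous g} /\ (forall x, K x -> f (g x) = x)) /\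
  (f 0 = 0 -> K 0 ->
   exists g : X -> X,
     [/\ {within K, continuous g}, forall x, K x -> f (g x) = x & g 0 = 0]).
Proof.
have [g [g_cont fgK g_f0]] :=
  right_inverse_on_compact f_C1 df_inv M_gt0 df_inv_le K_compact.
split; first by exists g.
by move=> f0 K0; exists g; split=> //; move: g_f0; rewrite f0; exact.
Qed.
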